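(* Let $\alpha,\beta\in\mathbb{E}$ with $\beta$ a pure quaternion, and let $p\in\mathbb{Z}$ be a prime. Then $p$ divides $\alpha\beta\overline{\alpha}$ if and only if one of the following holds: (1) $p$ divides $\alpha$ or $p$ divides $\beta$; (2) $p=2$, $p$ divides neither $\alpha$ nor $\beta$, but $p$ divides $N(\alpha)$; (3) $p>2$, $p$ divides neither $\alpha$ nor $\beta$, $p$ divides $N(\alpha)$, and there exist $\pi\in\mathbb{E}$ with $N(\pi)=p$ and $\alpha=\tau\pi$ for some $\tau\in\mathbb{E}$, and an integer $h\in\mathbb{Z}$ such that $h+\beta=\overline{\pi}\rho$ for some $\rho\in\mathbb{E}$. In particular, every prime divisor of $\alpha\beta\overline{\alpha}$ divides either $\beta$ or $N(\alpha)$.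
   Context: $\mathbb{E}$ denotes the ring of Hurwitz integral quaternions: quaternions $a+bi+cj+dk$ where either $a,b,c,d$ are all integers or all are halves of odd integers. For $\alpha=a+bi+cj+dk$: $\overline{\alpha}=a-bi-cj-dk$, $N(\alpha)=a^2+b^2+c^2+d^2$; $\alpha$ is pure if $a=0$. An integer prime $p$ divides $\gamma\in\mathbb{E}$ if $\gamma/p\in\mathbb{E}$. *)

(* Defs.v *)
From HB Require Import structures.
From mathcomp Require Import all_boot all_order all_algebra ring.

Set Implicit Arguments.
Unset Strict Implicit.
Unset Printing Implicit Defensive.

Import GRing.Theory Num.Theory.

Local Open Scope ring_scope.

Record quat (R : Type) := Quat { qre : R; qi : R; qj : R; qk : R }.

Section QuatCan.
Variable R : Type.

Definition tuple_of_quat (x : quat R) := (qre x, qi x, qj x, qk x).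

Definition quat_of_tuple (t : R * R * R * R) :=
  let: (a, b, c, d) := t in Quat a b c d.

Lemma tuple_of_quatK : cancel tuple_of_quat quat_of_tuple.
Proof. by case. Qed.
End QuatCan.

HB.instance Definition _ (R : eqType) :=
  Equality.copy (quat R) (can_type (@tuple_of_quatK R)).
HB.instance Definition _ (R : choiceType) :=
  Choice.copy (quat R) (can_type (@tuple_of_quatK R)).

Section QuatAlgebra.
Variable R : comNzRingType.
Implicit Types (a : R) (x y z : quat R).

Definition addq x y :=
  Quat (qre x + qre y) (qi x + qi y) (qj x + qj y) (qk x + qk y).

Definition oppq x := Quat (- qre x) (- qi x) (- qj x) (- qk x).

(* Hamilton's product: i^2 = j^2 = k^2 = ijk = -1. *)
Definition mulq x y :=
  Quat (qre x * qre y - qi x * qi y - qj x * qj y - qk x * qk y)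
       (qre x * qi y + qi x * qre y + qj x * qk y - qk x * qj y)
       (qre x * qj y - qi x * qk y + qj x * qre y + qk x * qi y)
       (qre x * qk y + qi x * qj y - qj x * qi y + qk x * qre y).

Definition scaleq a x := Quat (a * qre x) (a * qi x) (a * qj x) (a * qk x).

Fact addqA : associative addq.
Proof. by move=> [a b c d] [? ? ? ?] [? ? ? ?]; congr Quat; rewrite /= addrA. Qed.

Fact addqC : commutative addq.
Proof. by move=> [a b c d] [? ? ? ?]; congr Quat; rewrite /= addrC. Qed.

Fact add0q : left_id (Quat 0 0 0 0) addq.
Proof. by move=> [a b c d]; congr Quat; rewrite /= add0r. Qed.

Fact addNq : left_inverse (Quat 0 0 0 0) oppq addq.
Proof. by move=> [a b c d]; congr Quat; rewrite /= addNr. Qed.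

HB.instance Definition _ :=
  GRing.isZmodule.Build (quat R) addqA addqC add0q addNq.

Fact mulqA : associative mulq.
Proof. by move=> [a b c d] [? ? ? ?] [? ? ? ?]; congr Quat => /=; ring. Qed.

Fact mul1q : left_id (Quat 1 0 0 0) mulq.
Proof. by move=> [a b c d]; congr Quat => /=; ring. Qed.

Fact mulq1 : right_id (Quat 1 0 0 0) mulq.
Proof. by move=> [a b c d]; congr Quat => /=; ring. Qed.

Fact mulqDl : left_distributive mulq +%R.
Proof. by move=> [a b c d] [? ? ? ?] [? ? ? ?]; congr Quat => /=; ring. Qed.

Fact mulqDr : right_distributive mulq +%R.
Proof. by move=> [a b c d] [? ? ? ?] [? ? ? ?]; congr Quat => /=; ring. Qed.

Fact oneq_neq0 : Quat 1 0 0 0 != 0 :> quat R.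
Proof. by apply/eqP => -[/eqP]; rewrite oner_eq0. Qed.

HB.instance Definition _ :=
  GRing.Zmodule_isNzRing.Build (quat R) mulqA mul1q mulq1 mulqDl mulqDr oneq_neq0.

Fact scaleqA a b x : scaleq a (scaleq b x) = scaleq (a * b) x.
Proof. by congr Quat; rewrite /= mulrA. Qed.

Fact scale1q : left_id 1 scaleq.
Proof. by move=> [a b c d]; congr Quat; rewrite /= mul1r. Qed.

Fact scaleqDr : right_distributive scaleq +%R.
Proof. by move=> a [? ? ? ?] [? ? ? ?]; congr Quat; rewrite /= mulrDr. Qed.

Fact scaleqDl x : {morph scaleq^~ x : a b / a + b}.
Proof. by move=> a b; congr Quat; rewrite /= mulrDl. Qed.

HB.instance Definition _ :=
  GRing.Zmodule_isLmodule.Build R (quat R) scaleqA scale1q scaleqDr scaleqDl.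

Fact scaleqAl a x y : a *: (x * y) = a *: x * y.
Proof. by congr Quat => /=; ring. Qed.

HB.instance Definition _ := GRing.Lmodule_isLalgebra.Build R (quat R) scaleqAl.

Fact scaleqAr a x y : a *: (x * y) = x * (a *: y).
Proof. by congr Quat => /=; ring. Qed.

HB.instance Definition _ := GRing.Lalgebra_isAlgebra.Build R (quat R) scaleqAr.

Definition qconj x := Quat (qre x) (- qi x) (- qj x) (- qk x).

Definition qnorm x : R := qre x ^+ 2 + qi x ^+ 2 + qj x ^+ 2 + qk x ^+ 2.

Definition qpure : {pred quat R} := fun x => qre x == 0.

Lemma mulq_conj x : x * qconj x = (qnorm x)%:A.
Proof. by case: x => a b c d; congr Quat; rewrite /qnorm /=; ring. Qed.

End QuatAlgebra.

(* Hurwitz integers have rational coordinates, so they are carved out of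
   [quat rat]; no generality is lost with respect to real quaternions. *)
Definition half_odd : {pred rat} := fun x => x - 2^-1 \is a Num.int.

Definition hurwitz : {pred quat rat} := fun x =>
     [&& qre x \is a Num.int, qi x \is a Num.int,
         qj x \is a Num.int & qk x \is a Num.int]
  || [&& qre x \in half_odd, qi x \in half_odd,
         qj x \in half_odd & qk x \in half_odd].

(* Only meaningful for [p != 0], since [0^-1 = 0]. *)
Definition hdvd (p : nat) (x : quat rat) : bool := p%:R^-1 *: x \in hurwitz.

(* Main.v *)
(* If p divides x y x^*, multiplying by x^* and x gives p | N(x)^2 y, so p
   divides y or N(x).  In the latter case, if p does not divide x, the right gcd
   g = u x + p v of x and p, supplied by the Euclidean algorithm, has norm p, and
   p | g y g^*.  Hence g y = d g for some d.  For p odd some c has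
   tr(g c) = 1 mod p, and g z g = tr(g z) g mod p for every z, so that
   g y = d g = d g c g = g y c g = tr(g y c) g mod p:
   take h = - tr(g y c).  For p = 2 an even norm forces integral coordinates, and
   the rotation matrix of x is then visibly even. *)
Require Import Defs.
From HB Require Import structures.
From mathcomp Require Import all_boot all_order all_algebra.
From mathcomp Require Import ring lra.

Set Implicit Arguments.
Unset Strict Implicit.
Unset Printing Implicit Defensive.

Import Order.TTheory GRing.Theory Num.Theory.

Local Open Scope ring_scope.

(** * Coordinates, conjugation and the norm *)

Lemma eq_quat (R : Type) (x y : quat R) :
  qre x = qre y -> qi x = qi y -> qj x = qj y -> qk x = qk y -> x = y.
Proof. by case: x y => [a b c d] [a' b' c' d'] /= -> -> -> ->. Qed.

Section Coordinates.
Variable R : comNzRingType.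
Implicit Types (a : R) (x y : quat R).

Lemma qreD x y : qre (x + y) = qre x + qre y. Proof. by []. Qed.
Lemma qiD x y : qi (x + y) = qi x + qi y. Proof. by []. Qed.
Lemma qjD x y : qj (x + y) = qj x + qj y. Proof. by []. Qed.
Lemma qkD x y : qk (x + y) = qk x + qk y. Proof. by []. Qed.
Lemma qreN x : qre (- x) = - qre x. Proof. by []. Qed.
Lemma qiN x : qi (- x) = - qi x. Proof. by []. Qed.
Lemma qjN x : qj (- x) = - qj x. Proof. by []. Qed.
Lemma qkN x : qk (- x) = - qk x. Proof. by []. Qed.
Lemma qreZ a x : qre (a *: x) = a * qre x. Proof. by []. Qed.
Lemma qiZ a x : qi (a *: x) = a * qi x. Proof. by []. Qed.
Lemma qjZ a x : qj (a *: x) = a * qj x. Proof. by []. Qed.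
Lemma qkZ a x : qk (a *: x) = a * qk x. Proof. by []. Qed.
Lemma qreM x y :
  qre (x * y) = qre x * qre y - qi x * qi y - qj x * qj y - qk x * qk y.
Proof. by []. Qed.
Lemma qiM x y :
  qi (x * y) = qre x * qi y + qi x * qre y + qj x * qk y - qk x * qj y.
Proof. by []. Qed.
Lemma qjM x y :
  qj (x * y) = qre x * qj y - qi x * qk y + qj x * qre y + qk x * qi y.
Proof. by []. Qed.
Lemma qkM x y :
  qk (x * y) = qre x * qk y + qi x * qj y - qj x * qi y + qk x * qre y.
Proof. by []. Qed.
Lemma qre1 : qre (1 : quat R) = 1. Proof. by []. Qed.
Lemma qi1 : qi (1 : quat R) = 0. Proof. by []. Qed.
Lemma qj1 : qj (1 : quat R) = 0. Proof. by []. Qed.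
Lemma qk1 : qk (1 : quat R) = 0. Proof. by []. Qed.

Definition quatE := ((qreD, qiD, qjD, qkD), (qreN, qiN, qjN, qkN),
  (qreZ, qiZ, qjZ, qkZ), (qreM, qiM, qjM, qkM), (qre1, qi1, qj1, qk1)).

Lemma qconjE x :
  (qre (qconj x) = qre x) * (qi (qconj x) = - qi x) *
  (qj (qconj x) = - qj x) * (qk (qconj x) = - qk x).
Proof. by []. Qed.

Lemma qnormM x y : qnorm (x * y) = qnorm x * qnorm y.
Proof. by rewrite /qnorm !quatE; ring. Qed.

Lemma qnormZ a x : qnorm (a *: x) = a ^+ 2 * qnorm x.
Proof. by rewrite /qnorm !quatE; ring. Qed.

Lemma qnorm_conj x : qnorm (qconj x) = qnorm x.
Proof. by rewrite /qnorm !qconjE; ring. Qed.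

Lemma qconjK : involutive (@qconj R).
Proof. by move=> x; apply: eq_quat; rewrite !qconjE ?opprK. Qed.

Lemma mul_conjq x : qconj x * x = (qnorm x)%:A.
Proof. by rewrite -{2}[x]qconjK mulq_conj qnorm_conj. Qed.

Lemma qconjM x y : qconj (x * y) = qconj y * qconj x.
Proof. by apply: eq_quat; rewrite !(quatE, qconjE); ring. Qed.

Lemma qconjD x y : qconj (x + y) = qconj x + qconj y.
Proof. by apply: eq_quat; rewrite !(quatE, qconjE); ring. Qed.

Lemma qconjZ a x : qconj (a *: x) = a *: qconj x.
Proof. by apply: eq_quat; rewrite !(quatE, qconjE); ring. Qed.

(* Cayley-Hamilton for x * y; modulo a divisor of the norm of x it says that
   x y x is a scalar multiple of x. *)
Lemma mulq_sandwich x y :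
  x * y * x = (qre (x * y) *+ 2) *: x - qnorm x *: qconj y.
Proof. by apply: eq_quat; rewrite /qnorm !(quatE, qconjE) mulr2n; ring. Qed.

End Coordinates.

Lemma qnorm_ge0 (R : realDomainType) (x : quat R) : 0 <= qnorm x.
Proof. by rewrite !addr_ge0 ?sqr_ge0. Qed.

Lemma qnorm_eq0 (R : realDomainType) (x : quat R) : (qnorm x == 0) = (x == 0).
Proof.
apply/eqP/eqP => [|->]; last by rewrite /qnorm /=; ring.
move=> /eqP; rewrite !paddr_eq0 ?addr_ge0 ?sqr_ge0 // !sqrf_eq0.
by move=> /andP[/andP[/andP[/eqP x0 /eqP x1] /eqP x2] /eqP x3]; apply: eq_quat.
Qed.

(** * The ring of Hurwitz integers *)

Lemma int_parity (n : int) : exists k : int, n = k * 2 \/ n = k * 2 + 1.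
Proof.
exists (n %/ 2)%Z; have := divz_eq n 2.
have := modz_ge0 n (isT : (2 : int) != 0).
have := ltz_pmod n (isT : 0 < (2 : int)).
by case: (n %% 2)%Z => // -[|[|m]] // _ _ en; [left; rewrite -[RHS]addr0|right].
Qed.

(* Coordinates of x in the basis (1 + i + j + k)/2, i, j, k. *)
Lemma hurwitzE (x : quat rat) : x \in hurwitz =
  [&& 2 * qre x \is a Num.int, qi x - qre x \is a Num.int,
      qj x - qre x \is a Num.int & qk x - qre x \is a Num.int].
Proof.
have half_oddE u : (u \in half_odd) = (u - 2^-1 \is a Num.int) by [].
rewrite [LHS]unfold_in !half_oddE.
set a := qre x; set b := qi x; set c := qj x; set d := qk x.
apply/orP/and4P => [[|]/and4P[ha hb hc hd]|[/intrP[n an] hb hc hd]].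
- by split; rewrite ?rpredB ?rpredM.
- have sub u : u - 2^-1 \is a Num.int -> u - a \is a Num.int.
    move=> hu; have -> : u - a = (u - 2^-1) - (a - 2^-1) by ring.
    exact: rpredB.
  split; [|exact: sub..].
  have -> : 2 * a = 2 * (a - 2^-1) + 1 by field.
  by rewrite rpredD // rpredM.
- have e : a = n%:~R / 2 by rewrite -an; field.
  (* The parity of [n = 2 * a] decides between integral and half-odd coordinates; the other three
     follow [a]. *)
  have int_or_half : a \is a Num.int \/ a - 2^-1 \is a Num.int.
    have [k [] en] := int_parity n; [left|right]; rewrite e en ?intrD intrM.
      by rewrite mulfK ?intr_int.
    by rewrite mulrDl mulfK // mul1r addrK intr_int.
  case: int_or_half => ha; [left|right].
    have add u : u - a \is a Num.int -> u \is a Num.int.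
      by move=> hu; rewrite -[u](subrK a) rpredD.
    by apply/and4P; split=> //; apply: add.
  have add u : u - a \is a Num.int -> u - 2^-1 \is a Num.int.
    by move=> hu; rewrite -[u](subrK a) -addrA rpredD.
  by apply/and4P; split=> //; apply: add.
Qed.

Fact hurwitz_subring : subring_closed hurwitz.
Proof.
split=> [|x y|x y]; first by [].
- rewrite !hurwitzE => /and4P[x0 x1 x2 x3] /and4P[y0 y1 y2 y3].
  have e u v : (u - v) - (qre x - qre y) = (u - qre x) - (v - qre y) :> rat by ring.
  rewrite !quatE mulrBr !e.
  by apply/and4P; split; apply: rpredB.
rewrite !hurwitzE.
(* Passing to the coordinates of [hurwitzE] turns each membership into a polynomial identity over
   integers, the denominators cancelling. *)
have decomp z : [/\ qi z = (qi z - qre z) + (2 * qre z) / 2,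
  qj z = (qj z - qre z) + (2 * qre z) / 2,
  qk z = (qk z - qre z) + (2 * qre z) / 2 & qre z = (2 * qre z) / 2 :> rat].
  by split; field.
case: (decomp x) (decomp y) => [ex1 ex2 ex3 ex0] [ey1 ey2 ey3 ey0].
rewrite !quatE.
move: ex1 ex2 ex3 ex0 ey1 ey2 ey3 ey0.
move: (2 * qre x) (qi x - qre x) (qj x - qre x) (qk x - qre x) => a b c d.
move: (2 * qre y) (qi y - qre y) (qj y - qre y) (qk y - qre y) => a' b' c' d'.
move=> -> -> -> -> -> -> -> -> /and4P[x0 x1 x2 x3] /and4P[y0 y1 y2 y3].
have intE := (rpredD, rpredB, rpredN, rpredM).
set r := (X in 2 * X).
have -> : 2 * r = - (a * a') - a * (b' + c' + d') - a' * (b + c + d)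
                  - 2 * (b * b' + c * c' + d * d') by rewrite /r; field.
apply/and4P; split; first by rewrite !intE.
- set u := (X in X - r).
  have -> : u - r = a * a' + a * b' + a' * b + a * d' + a' * c
      + b * b' + c * c' + d * d' + c * d' - d * c' by rewrite /u /r; field.
  by rewrite !intE.
- set u := (X in X - r).
  have -> : u - r = a * a' + a * c' + a' * c + a * b' + a' * d
      + b * b' + c * c' + d * d' + d * b' - b * d' by rewrite /u /r; field.
  by rewrite !intE.
- set u := (X in X - r).
  have -> : u - r = a * a' + a * d' + a' * d + a * c' + a' * b
      + b * b' + c * c' + d * d' + b * c' - c * b' by rewrite /u /r; field.
  by rewrite !intE.
Qed.

HB.instance Definition _ :=
  GRing.isSubringClosed.Build (quat rat) hurwitz hurwitz_subring.

Lemma hurwitz_re2 x : x \in hurwitz -> 2 * qre x \is a Num.int.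
Proof. by rewrite hurwitzE => /and4P[]. Qed.

(** The conjugate is the trace, an integer, minus [x]. *)
Lemma hurwitz_conj x : x \in hurwitz -> qconj x \in hurwitz.
Proof.
move=> xE; have re2 := hurwitz_re2 xE.
have -> : qconj x = (2 * qre x)%:A - x.
  by apply: eq_quat; rewrite !(quatE, qconjE); ring.
have /intrP[n ->] := re2.
by rewrite rpredB // scaler_int rpredMz ?rpred1.
Qed.

Lemma hurwitzZ a x : a \is a Num.int -> x \in hurwitz -> a *: x \in hurwitz.
Proof. by move=> /intrP[n ->] xE; rewrite scaler_int rpredMz. Qed.

(** In the coordinates of [hurwitzE] the norm is a quadratic form with integer coefficients. *)
Lemma hurwitz_qnorm x : x \in hurwitz -> qnorm x \is a Num.nat.
Proof.
move=> xE; rewrite natrEint qnorm_ge0 andbT; move: xE; rewrite hurwitzE.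
have -> : qnorm x = (2 * qre x) ^+ 2
    + 2 * qre x * ((qi x - qre x) + (qj x - qre x) + (qk x - qre x))
    + (qi x - qre x) ^+ 2 + (qj x - qre x) ^+ 2 + (qk x - qre x) ^+ 2.
  by rewrite /qnorm; ring.
move: (2 * qre x) (qi x - qre x) (qj x - qre x) (qk x - qre x) => a b c d.
by move=> /and4P[a_int b_int c_int d_int]; rewrite !(rpredD, rpredM, rpredX).
Qed.

(** * Divisibility by a rational prime *)

Lemma hdvdP (p : nat) x : (0 < p)%N ->
  reflect (exists2 y, y \in hurwitz & x = p%:R *: y) (hdvd p x).
Proof.
move=> p_gt0; have p0 : p%:R != 0 :> rat by rewrite pnatr_eq0 -lt0n.
apply: (iffP idP) => [xE|[y yE ->]]; last by rewrite /hdvd scalerK.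
by exists (p%:R^-1 *: x); rewrite // scalerA divff // scale1r.
Qed.

Lemma hdvdZ (p : nat) a x : a \is a Num.int -> hdvd p x -> hdvd p (a *: x).
Proof. by move=> a_int; rewrite /hdvd scalerA mulrC -scalerA; apply: hurwitzZ. Qed.

Lemma hdvdMl (p : nat) x y : x \in hurwitz -> hdvd p y -> hdvd p (x * y).
Proof. by move=> xE yE; rewrite /hdvd scalerAr rpredM. Qed.

Lemma hdvdMr (p : nat) x y : y \in hurwitz -> hdvd p x -> hdvd p (x * y).
Proof. by move=> xE yE; rewrite /hdvd scalerAl rpredM. Qed.

Lemma hdvdD (p : nat) x y : hdvd p x -> hdvd p y -> hdvd p (x + y).
Proof. by rewrite /hdvd scalerDr; apply: rpredD. Qed.

Lemma hdvd_scale_prime (p : nat) n x : (0 < p)%N -> x \in hurwitz ->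
  hdvd p (p%:R * n%:~R *: x).
Proof.
move=> p_gt0 xE; apply/hdvdP => //; exists (n%:~R *: x); last by rewrite scalerA.
exact: hurwitzZ (intr_int _ n) xE.
Qed.

(** A relation [u n + v p = 1] writes [x] as a combination of [n x] and [p x]. *)
Lemma hdvd_coprimeZ (p : nat) (n : int) x : (0 < p)%N -> coprimez n p ->
  x \in hurwitz -> hdvd p (n%:~R *: x) -> hdvd p x.
Proof.
move=> p_gt0 /coprimezP[[u v] /= uv1] xE nx.
have -> : x = u%:~R *: (n%:~R *: x) + p%:R * v%:~R *: x.
  rewrite scalerA -scalerDl -[LHS]scale1r; congr (_ *: _).
  by rewrite [p%:R * _]mulrC -[p%:R]/(p%:Z%:~R) -!intrM -intrD uv1.
by apply: hdvdD; [apply: hdvdZ => //; exact: intr_int | apply: hdvd_scale_prime].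
Qed.

Lemma coprimez_prime (p : nat) (n : int) :
  prime p -> ~~ (p%:Z %| n)%Z -> coprimez n p.
Proof.
by move=> p_prime; rewrite coprimezE coprime_sym prime_coprime // dvdzE.
Qed.

Lemma intr_dvdz (p : nat) (n : int) : (0 < p)%N ->
  (n%:~R / p%:R : rat) \is a Num.int = (p%:Z %| n)%Z.
Proof.
move=> p_gt0; have p0 : p%:R != 0 :> rat by rewrite pnatr_eq0 -lt0n.
apply/idP/dvdzP => [/intrP[m em]|[m ->]].
  exists m; apply/eqP; rewrite -(eqr_int rat) intrM -em.
  by rewrite -[p%:Z%:~R]/(p%:R) divfK.
by rewrite intrM -[p%:Z%:~R]/(p%:R) mulfK ?intr_int.
Qed.

(** Gives the assertion on prime divisors, and the condition on the norm in cases (2) and (3). *)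
Lemma hdvd_conjugate (p : nat) x y : prime p ->
  x \in hurwitz -> y \in hurwitz -> hdvd p (x * y * qconj x) ->
  hdvd p y \/ qnorm x / p%:R \is a Num.int.
Proof.
move=> p_prime xE yE dvd_xyx; have p_gt0 := prime_gt0 p_prime.
have /natrP[n en] := hurwitz_qnorm xE.
case: (boolP (qnorm x / p%:R \is a Num.int)) => [|ndvd]; [by right|left].
have cop : coprimez (n%:Z ^+ 2) p.
  rewrite coprimezXl // coprimez_prime //.
  by rewrite -intr_dvdz // -[n%:~R]/(n%:R) -en.
apply: (hdvd_coprimeZ p_gt0 cop) => //.
have -> : (n%:Z ^+ 2)%:~R *: y = qconj x * (x * y * qconj x) * x.
  rewrite !mulrA mul_conjq mulr_algl -!mulrA mul_conjq -scalerAl -scalerAr mulr1.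
  by rewrite scalerA en rmorphXn expr2.
by apply: hdvdMr => //; apply: hdvdMl => //; apply: hurwitz_conj.
Qed.

(** * Euclidean division and right gcds *)

(** The equality case is recorded because rounding to integral coordinates fails to bring the norm
    below 1 only when all four coordinates are ties. *)
Lemma rat_round (r : rat) : exists2 z : int, (r - z%:~R) ^+ 2 <= 1 / 4 &
  (r - z%:~R) ^+ 2 = 1 / 4 -> r - 2^-1 \is a Num.int.
Proof.
pose z := Num.floor (r + 1 / 2); exists z.
  have /andP[] := floor_itv (r + 1 / 2); rewrite -/z intrD; set w := z%:~R.
  move=> h1 h2.
  have -> : 1 / 4 = (1 / 2) ^+ 2 :> rat by field.
  rewrite -subr_ge0 subr_sqr; apply: mulr_ge0; lra.
(* A tie factors as a difference of squares, so [r] is [z + 1/2] or [z - 1/2]. *)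
move=> /eqP h; have : ((r - z%:~R) - 1 / 2) * ((r - z%:~R) + 1 / 2) == 0.
  by move/eqP: h; rewrite -subr_sqr => ->; apply/eqP; field.
rewrite mulf_eq0 => /orP[]/eqP h'.
  have -> : r - 2^-1 = z%:~R by lra.
  exact: intr_int.
have -> : r - 2^-1 = (z - 1)%:~R by rewrite intrB; lra.
exact: intr_int.
Qed.

Lemma hurwitz_round x : exists2 q, q \in hurwitz & qnorm (x - q) < 1.
Proof.
have [a ha ha'] := rat_round (qre x); have [b hb hb'] := rat_round (qi x).
have [c hc hc'] := rat_round (qj x); have [d hd hd'] := rat_round (qk x).
pose q := Quat (a%:~R : rat) b%:~R c%:~R d%:~R.
have qE : q \in hurwitz by rewrite hurwitzE /= !rpredB ?rpredM ?intr_int.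
have nq : qnorm (x - q) = (qre x - a%:~R) ^+ 2 + (qi x - b%:~R) ^+ 2
  + (qj x - c%:~R) ^+ 2 + (qk x - d%:~R) ^+ 2 by [].
case: (ltP (qnorm (x - q)) 1) => [|ge1]; first by exists q.
(* Every coordinate of x is then exactly half-way between two integers,
   so that x itself is a Hurwitz integer. *)
exists x; last by rewrite subrr /qnorm /= expr0n !addr0.
rewrite nq in ge1.
by apply/orP; right; apply/and4P; split; [apply: ha'|apply: hb'|apply: hc'|apply: hd'];
  apply/eqP; rewrite eq_le; apply/andP; split=> //; lra.
Qed.

(** Round the quotient of [x] by [y], namely [x * qconj y] over [qnorm y]: the remainder is the
    rounding error times [y], and the norm is multiplicative. *)
Lemma hurwitz_edivr x y : x \in hurwitz -> y \in hurwitz -> y != 0 ->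
  exists2 q, q \in hurwitz & qnorm (x - q * y) < qnorm y.
Proof.
move=> xE yE y0; have ny0 : qnorm y != 0 by rewrite qnorm_eq0.
have [q qE q1] := hurwitz_round ((qnorm y)^-1 *: (x * qconj y)).
exists q => //.
have -> : x - q * y = ((qnorm y)^-1 *: (x * qconj y) - q) * y.
  rewrite mulrBl -scalerAl -mulrA mul_conjq -scalerAr mulr1 scalerA.
  by rewrite mulVf // scale1r.
by rewrite qnormM gtr_pMl // lt_def ny0 qnorm_ge0.
Qed.

(** Euclid's algorithm, by induction on the norm of [y]. Quotients multiply on the left, so [g] is a
    common right divisor. *)
Lemma hurwitz_bezout x y : x \in hurwitz -> y \in hurwitz ->
  exists g u v s t, [/\ u \in hurwitz, v \in hurwitz, s \in hurwitz & t \in hurwitz] /\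
    [/\ g = u * x + v * y, x = s * g & y = t * g].
Proof.
move=> xE yE; have /natrP[n] := hurwitz_qnorm yE.
elim/ltn_ind: n => n IH in x y xE yE * => en.
have [->|y0] := eqVneq y 0.
  exists x, 1, 0, 1, 0; rewrite !mul1r !mul0r addr0.
  by split; split; rewrite ?rpred0 ?rpred1.
have [q qE lt_r] := hurwitz_edivr xE yE y0.
have rE : x - q * y \in hurwitz by rewrite rpredB ?rpredM.
have /natrP[m em] := hurwitz_qnorm rE.
have [|g [u [v [s [t [[uE vE sE tE] [eg ey er]]]]]]] := IH m _ _ _ yE rE em.
  by rewrite -(ltr_nat rat) -em -en.
(* Back-substitution of the remainder [x - q * y] into the relations for [y] and that remainder. *)
exists g, v, (u - v * q), (t + q * s), s; split; split=> //.
- by rewrite rpredB ?rpredM.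
- by rewrite rpredD ?rpredM.
- by rewrite eg mulrBr mulrBl mulrA addrC -addrA [_ - _]addrC.
- by rewrite mulrDl -mulrA -er -ey subrK.
Qed.

(** * Right factors of norm [p] *)

Lemma qnormD (R : comNzRingType) (x y : quat R) :
  qnorm (x + y) = qnorm x + 2 * qre (x * qconj y) + qnorm y.
Proof. by rewrite /qnorm !(quatE, qconjE); ring. Qed.

(** Take for [g] the right gcd of [x] and [p]. Its norm divides [N(p) = p^2]. It is not 1, as [p]
    divides the norm of [u x + p v]; it is not [p^2], as then [g] would be a unit times [p] and [p]
    would divide [x]. *)
Lemma hurwitz_right_factor (p : nat) x : prime p -> x \in hurwitz ->
    ~~ hdvd p x -> qnorm x / p%:R \is a Num.int ->
  exists g u v s, [/\ g \in hurwitz, u \in hurwitz, v \in hurwitz & s \in hurwitz] /\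
    [/\ qnorm g = p%:R, x = s * g & g = u * x + p%:R *: v].
Proof.
move=> p_prime xE ndvd px; have p_gt0 := prime_gt0 p_prime.
have p0 : p%:R != 0 :> rat by rewrite pnatr_eq0 -lt0n.
have yE : p%:R%:A \in hurwitz by apply: hurwitzZ; rewrite ?natr_int ?rpred1.
have [g [u [v [s [t [[uE vE sE tE] [eg ex ey]]]]]]] := hurwitz_bezout xE yE.
rewrite -scalerAr mulr1 in eg.
have gE : g \in hurwitz by rewrite eg rpredD ?rpredM ?hurwitzZ ?natr_int.
exists g, u, v, s; split; split=> //.
have /natrP[ng eng] := hurwitz_qnorm gE; have /natrP[nt ent] := hurwitz_qnorm tE.
have q1 : qnorm (1 : quat rat) = 1 by rewrite /qnorm !quatE; ring.
have e : (nt * ng = p ^ 2)%N.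
  apply/eqP; rewrite -(eqr_nat rat) natrM natrX -ent -eng -qnormM -ey.
  by rewrite qnormZ q1 mulr1.
have /(dvdn_pfactor _ _ p_prime)[[|[|[|//]]] _ em] : (ng %| p ^ 2)%N.
- by rewrite -e dvdn_mull.
- suff : (1%:~R / p%:R : rat) \is a Num.int.
    by rewrite intr_dvdz // dvdzE dvdn1 /= => /eqP p1; rewrite p1 in p_prime.
  (* If [N(g) = 1], expanding the norm of [u x + p v] and dividing by [p] makes [1/p] a sum of
     integers. *)
  have -> : (1%:~R / p%:R : rat) = qnorm u * (qnorm x / p%:R)
      + 2 * qre (u * x * qconj v) + p%:R * qnorm v.
    have := eng; rewrite em eg qnormD qconjZ -scalerAr qreZ qnormZ qnormM => e1.
    by rewrite -[1%:~R]/(p ^ 0)%:R -e1; field.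
  have norm_int z : z \in hurwitz -> qnorm z \is a Num.int.
    by move=> /hurwitz_qnorm; rewrite natrEint => /andP[].
  apply: rpredD; last by rewrite rpredM ?natr_int ?norm_int.
  apply: rpredD; first by rewrite rpredM ?norm_int.
  by apply: hurwitz_re2; rewrite !rpredM ?hurwitz_conj.
- by rewrite eng em expn1.
- have nt1 : qnorm t = 1.
    move/eqP: e; rewrite em -[X in _ == X]mul1n eqn_pmul2r ?expn_gt0 ?p_gt0 //.
    by move=> /eqP nt1; rewrite ent nt1.
  case/negP: ndvd; apply/hdvdP => //; exists (s * qconj t).
    by rewrite rpredM ?hurwitz_conj.
  have g_eq : g = qconj t * p%:R%:A by rewrite ey mulrA mul_conjq nt1 mulr_algl scale1r.
  by rewrite {1}ex g_eq mulrA -scalerAr mulr1.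
Qed.

(** * Odd primes: the trace form and the integer [h] *)

(** The trace form is nondegenerate modulo an odd [p]. Up to sign, the traces of [x] against 1, i,
    j, k are twice its coordinates; if [p] divided all four, it would divide [2 x], hence [x]. *)
Lemma hurwitz_trace_coprime (p : nat) x : prime p -> (2 < p)%N ->
    x \in hurwitz -> ~~ hdvd p x ->
  exists2 c, c \in hurwitz & exists2 t : int, 2 * qre (x * c) = t%:~R & coprimez t p.
Proof.
move=> p_prime p_gt2 xE ndvd; have p_gt0 := prime_gt0 p_prime.
pose good c := (c \in hurwitz) && ~~ (2 * qre (x * c) / p%:R \is a Num.int).
have goodP c : good c -> exists2 c, c \in hurwitz &
    exists2 t : int, 2 * qre (x * c) = t%:~R & coprimez t p.
  case/andP=> cE nint; exists c => //.
  have /intrP[t et] : 2 * qre (x * c) \is a Num.int by rewrite hurwitz_re2 ?rpredM.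
  by exists t; rewrite // coprimez_prime // -intr_dvdz // -et.
pose e1 := Quat (0 : rat) 1 0 0; pose e2 := Quat (0 : rat) 0 1 0.
pose e3 := Quat (0 : rat) 0 0 1.
have [/goodP//|n0] := boolP (good 1); have [/goodP//|n1] := boolP (good e1).
have [/goodP//|n2] := boolP (good e2); have [/goodP//|n3] := boolP (good e3).
case/negP: ndvd.
have cop2 : coprimez 2 p.
  rewrite coprimezE coprime_sym prime_coprime //.
  by apply/negP => /(dvdn_leq (isT : (0 < `|2|)%N)); rewrite leqNgt p_gt2.
apply: (hdvd_coprimeZ p_gt0 cop2 xE).
move: n0 n1 n2 n3; rewrite /good !negb_and !negbK mulr1 rpred1 /=.
have -> : 2 * qre (x * e1) = - (2 * qi x) by rewrite quatE /=; ring.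
have -> : 2 * qre (x * e2) = - (2 * qj x) by rewrite quatE /=; ring.
have -> : 2 * qre (x * e3) = - (2 * qk x) by rewrite quatE /=; ring.
rewrite !mulNr !rpredN => h0 h1 h2 h3.
by apply/orP; left; rewrite !quatE ![_^-1 * _]mulrC h0 h1 h2 h3.
Qed.

(** Modulo [p], [g] is an eigenvector of right multiplication by [b], with eigenvalue [-h].
    Multiplying [g (h + b) = p r] by [qconj g] on the left and cancelling [p] gives the
    factorization. *)
Lemma hurwitz_eigen_scalar (p : nat) g b : prime p -> (2 < p)%N ->
    g \in hurwitz -> b \in hurwitz -> qnorm g = p%:R ->
    hdvd p (g * b * qconj g) ->
  exists h : int, exists2 r, r \in hurwitz & h%:~R + b = qconj g * r.
Proof.
move=> p_prime p_gt2 gE bE ng; have p_gt0 := prime_gt0 p_prime.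
have p0 : p%:R != 0 :> rat by rewrite pnatr_eq0 -lt0n.
move=> /(hdvdP _ p_gt0)[d dE ed].
have gb : g * b = d * g.
  apply: (scalerI p0); rewrite [RHS]scalerAl -ed -[RHS]mulrA mul_conjq ng.
  by rewrite -scalerAr mulr1.
(* Otherwise [p^2] would divide [N(g) = p]. *)
have ndvd : ~~ hdvd p g.
  apply/(hdvdP _ p_gt0) => -[y /hurwitz_qnorm/natrP[n en] ey].
  move: ng; rewrite ey qnormZ en -natrX -natrM => /eqP; rewrite eqr_nat.
  rewrite expnS expn1 -mulnA -[X in _ == X]muln1 eqn_pmul2l // muln_eq1.
  by case: eqP p_gt2 => // ->.
have [c cE [t et /coprimezP[[u v] /= uv1]]] :=
  hurwitz_trace_coprime p_prime p_gt2 gE ndvd.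
(* Scaling by the inverse [u] of [t] modulo [p] makes the trace of [g * c'] congruent to 1. *)
pose c' := u%:~R *: c.
have c'E : c' \in hurwitz by rewrite hurwitzZ ?intr_int.
have {}et : qre (g * c') *+ 2 = 1 - p%:R * v%:~R.
  have -> : qre (g * c') *+ 2 = u%:~R * (2 * qre (g * c)) by rewrite -scalerAr qreZ; ring.
  rewrite et -intrM.
  rewrite -[p%:R]/(p%:Z%:~R) -intrM [p%:Z * v]mulrC -[1]/(1%:~R) -intrB.
  by congr (_%:~R); rewrite -uv1 addrK.
have gE1 : g = g * c' * g + p%:R *: (v%:~R *: g + qconj c').
  rewrite mulq_sandwich et ng scalerBl scale1r scalerDr scalerA.
  by rewrite addrACA subrK addNr addr0.
have /intrP[k ek] : 2 * qre (g * (b * c')) \is a Num.int.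
  by rewrite hurwitz_re2 ?rpredM.
have {}ek : qre (g * (b * c')) *+ 2 = k%:~R by rewrite -ek; ring.
(* The quotient by [p] of [g * (b - k)]: expand [d * g] by [gE1], replace [d * g] by [g * b], and
   apply [mulq_sandwich] to [g * (b * c') * g]. *)
pose r := d * (v%:~R *: g + qconj c') - qconj (b * c').
have gh : g * ((- k)%:~R + b) = p%:R *: r.
  rewrite mulrDr gb {2}gE1 mulrDr !mulrA -gb -[g * b * c']mulrA mulq_sandwich.
  rewrite ek ng -scaler_int -[g * _]scalerAr mulr1 -[d * _]scalerAr.
  by rewrite /r scalerBr rmorphN scaleNr -addrA addKr addrC.
exists (- k), r.
  by rewrite rpredB ?hurwitz_conj ?rpredM ?rpredD ?hurwitz_conj ?hurwitzZ ?intr_int.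
apply: (scalerI p0).
by rewrite [RHS]scalerAr -gh mulrA mul_conjq ng mulr_algl.
Qed.

(** * The prime 2 *)

Lemma int_mul_succ_half (a : rat) : a \is a Num.int ->
  a * (a + 1) / 2 \is a Num.int.
Proof.
case/intrP=> n ->; have [k [->|->]] := int_parity n.
  rewrite (_ : _ / 2 = (k * (k * 2 + 1))%:~R) ?intr_int //.
  by rewrite !(intrM, intrD); field.
rewrite (_ : _ / 2 = ((k * 2 + 1) * (k + 1))%:~R) ?intr_int //.
by rewrite !(intrM, intrD); field.
Qed.

(** Odd squares are 1 modulo 8, so the square of a half-odd number is 1/4 plus an even integer, and
    four of them add up to an odd norm. *)
Lemma hurwitz_even_norm x : x \in hurwitz -> qnorm x / 2 \is a Num.int ->
  [/\ qre x \is a Num.int, qi x \is a Num.int,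
      qj x \is a Num.int & qk x \is a Num.int].
Proof.
move=> /orP[/and4P[] //|/and4P[a_int b_int c_int d_int] even].
have half (u : rat) : u - 2^-1 \is a Num.int -> (u ^+ 2 - 1 / 4) / 2 \is a Num.int.
  have -> : (u ^+ 2 - 1 / 4) / 2 = (u - 2^-1) * (u - 2^-1 + 1) / 2 by field.
  exact: int_mul_succ_half.
suff : (1%:~R / 2%:R : rat) \is a Num.int by rewrite intr_dvdz.
have -> : (1%:~R / 2%:R : rat) = qnorm x / 2 - (qre x ^+ 2 - 1 / 4) / 2
    - (qi x ^+ 2 - 1 / 4) / 2 - (qj x ^+ 2 - 1 / 4) / 2 - (qk x ^+ 2 - 1 / 4) / 2.
  by rewrite /qnorm; field.
by do 4![apply: rpredB; last exact: half].
Qed.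

(** In the matrix of the rotation, off-diagonal entries carry a factor 2, and diagonal ones are the
    norm minus twice two squares. *)
Lemma hdvd2_conjugate_pure x b : x \in hurwitz -> b \in hurwitz ->
  b \in @qpure rat -> qnorm x / 2 \is a Num.int -> hdvd 2 (x * b * qconj x).
Proof.
move=> xE bE /eqP b0 even; have [x0 x1 x2 x3] := hurwitz_even_norm xE even.
(* With real part 0, the other coordinates of [b] are integers. *)
move: bE; rewrite hurwitzE b0 !subr0 => /and4P[_ b1 b2 b3].
have intE := (rpredD, rpredB, rpredN, rpredM, rpredX).
apply/orP; left; rewrite !(quatE, qconjE) b0; apply/and4P; split.
- by rewrite (_ : _ * _ = 0) ?rpred0 //; ring.
- set u := (X in X \is a _).
  have -> : u = (qnorm x / 2 - qj x ^+ 2 - qk x ^+ 2) * qi b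
    + (qi x * qj x - qre x * qk x) * qj b + (qi x * qk x + qre x * qj x) * qk b.
    by rewrite /u /qnorm; field.
  by move: (qnorm x / 2) even => m m_int; rewrite !intE.
- set u := (X in X \is a _).
  have -> : u = (qnorm x / 2 - qi x ^+ 2 - qk x ^+ 2) * qj b
    + (qi x * qj x + qre x * qk x) * qi b + (qj x * qk x - qre x * qi x) * qk b.
    by rewrite /u /qnorm; field.
  by move: (qnorm x / 2) even => m m_int; rewrite !intE.
- set u := (X in X \is a _).
  have -> : u = (qnorm x / 2 - qi x ^+ 2 - qj x ^+ 2) * qk b
    + (qi x * qk x - qre x * qj x) * qi b + (qj x * qk x + qre x * qi x) * qj b.
    by rewrite /u /qnorm; field.
  by move: (qnorm x / 2) even => m m_int; rewrite !intE.
Qed.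

(** * Assembly of the three cases and their converses *)

Theorem theorem4p6 (alpha beta : quat rat) (p : nat)
    (alphaE : alpha \in hurwitz) (betaE : beta \in hurwitz)
    (beta_pure : beta \in @qpure rat) (p_prime : prime p) :
  (hdvd p (alpha * beta * qconj alpha) <->
     [\/ hdvd p alpha \/ hdvd p beta,
         [/\ p = 2%N, ~ hdvd p alpha, ~ hdvd p beta
           & qnorm alpha / p%:R \is a Num.int]
       | [/\ (2 < p)%N, ~ hdvd p alpha, ~ hdvd p beta,
             qnorm alpha / p%:R \is a Num.int
           & exists pi : quat rat,
               [/\ pi \in hurwitz, qnorm pi = p%:R,
                   exists2 tau, tau \in hurwitz & alpha = tau * pi
                 & exists h : int,
                     exists2 rho, rho \in hurwitz
                       & h%:~R + beta = qconj pi * rho]]])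
  /\ (forall q : nat, prime q -> hdvd q (alpha * beta * qconj alpha) ->
        hdvd q beta \/ qnorm alpha / q%:R \is a Num.int).
Proof.
have p_gt0 := prime_gt0 p_prime.
split; last by move=> q q_prime; apply: hdvd_conjugate.
split=> [dvd_aba|[[p_alpha|p_beta]|[p2 _ _ even]|[_ _ _ _ [pi [piE npi]]]]].
- have [p_alpha|/negP p_alpha] := boolP (hdvd p alpha); first by apply: Or31; left.
  have [p_beta|/negP p_beta] := boolP (hdvd p beta); first by apply: Or31; right.
  have [//|p_norm] := hdvd_conjugate p_prime alphaE betaE dvd_aba.
  have := prime_gt1 p_prime; rewrite leq_eqVlt => /orP[/eqP p2|p_gt2].
    by apply: Or32.
  apply: Or33; split=> //.
  have [|g [u [v [s [[gE uE vE sE] [ng ea eg]]]]]] :=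
    hurwitz_right_factor p_prime alphaE _ p_norm; first exact/negP.
  exists g; split=> //; first by exists s.
  apply: (hurwitz_eigen_scalar p_prime p_gt2 gE betaE ng).
  (* As [g] is [u * alpha] modulo [p], divisibility passes from the conjugate by [alpha] to the
     conjugate by [g]. *)
  have -> : g * beta * qconj g = u * (alpha * beta * qconj alpha) * qconj u
      + p%:R *: (u * alpha * beta * qconj v + v * beta * qconj g).
    rewrite {1}eg !mulrDl {1}eg qconjD qconjZ qconjM mulrDr scalerDr.
    by rewrite -!scalerAl -scalerAr !mulrA addrA.
  have hc := hurwitz_conj.
  apply: hdvdD; first by apply: hdvdMr; [exact: hc|apply: hdvdMl].
  apply/hdvdP => //; eexists; last by [].
  by rewrite rpredD ?rpredM ?hc.
- by rewrite -mulrA; apply: hdvdMr; rewrite ?rpredM ?hurwitz_conj.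
- by apply: hdvdMr; [exact: hurwitz_conj|apply: hdvdMl].
- by rewrite p2 hdvd2_conjugate_pure // -[2]/(2%:R) -p2.
- case=> tau tauE -> [h [rho rhoE erho]].
  (* Multiply [h + beta = qconj pi * rho] by [pi] on the left, using [N(pi) = p]. *)
  have pb : pi * beta = p%:R *: rho - h%:~R *: pi.
    apply/eqP; rewrite eq_sym subr_eq -npi -mulr_algl -mulq_conj -mulrA -erho.
    by rewrite mulrDr -scaler_int -scalerAr mulr1 addrC.
  (* Multiplying [pb] by [qconj pi] on the right exhibits the factor [p] between [tau] and its
     conjugate. *)
  have -> : tau * pi * beta * qconj (tau * pi) =
      tau * (p%:R *: (rho * qconj pi - h%:~R)) * qconj tau.
    rewrite qconjM !mulrA; congr (_ * _); rewrite -!mulrA; congr (_ * _).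
    rewrite mulrA pb mulrBl -!scalerAl mulq_conj npi scalerA.
    by rewrite [h%:~R * _]mulrC -scalerA scaler_int scalerBr.
  have hc := hurwitz_conj.
  apply: hdvdMr; first exact: hc.
  apply: hdvdMl => //; apply/hdvdP => //; eexists; last by [].
  by rewrite rpredB ?rpredM ?hc ?rpred_int.
Qed.
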